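(* Let $G=(X,Y)$ be a bipartite graph satisfying the double Hall property with $|X|=n\ge 2$ and maximum degree $\Delta(G)=d$. Then $n\le \binom d2+1$; consequently $d\ge \sqrt{2n}$.
   Context: All graphs are finite and simple. For a vertex set $S$, $\Lambda^2(S)$ denotes the set of vertices adjacent to at least two vertices of $S$. A bipartite graph $G=(X,Y)$ with $|X|\ge 2$ satisfies the double Hall property if $|\Lambda^2(S)|\ge |S|$ for every $S\subseteq X$ with $|S|\ge 2$. *)

(* Defs.v *)
From mathcomp Require Import all_boot all_order all_algebra.

Set Implicit Arguments.
Unset Strict Implicit.
Unset Printing Implicit Defensive.

Record sgraph := SGraph {
  vertex :> finType;
  adj : rel vertex;
  adj_sym : symmetric adj;
  adj_irrefl : irreflexive adj
}.

Section GraphNotions.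
Variable G : sgraph.
Implicit Types (u v : G) (S X Y : {set G}).

Definition nbhd v : {set G} := [set u | adj v u].

Definition degree v : nat := #|nbhd v|.

Definition max_degree : nat := \max_(v : G) degree v.

Definition bipartition X Y : Prop :=
  [/\ X :|: Y = [set: G],
      [disjoint X & Y]
    & forall u v, adj u v ->
        (u \in X /\ v \in Y) \/ (u \in Y /\ v \in X)].

Definition Lambda2 S : {set G} := [set v | 2 <= #|nbhd v :&: S|].

(* The standing assumption #|X| >= 2 is not part of this predicate. *)
Definition double_Hall X : Prop :=
  forall S, S \subset X -> 2 <= #|S| -> #|S| <= #|Lambda2 S|.

End GraphNotions.

(* Main.v *)
Require Import Defs.
From mathcomp Require Import all_boot all_order all_algebra.

(** Fix x in X. By the double Hall property on pairs, every other vertex of X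
    has at least two common neighbours with x, so at least 2(n-1) paths of
    length two join x to X :\ x. On the other hand x has at most d
    neighbours, each with at most d-1 neighbours other than x. Hence
    2(n-1) <= d(d-1). *)

Lemma degree_le_max {G : sgraph} (v : G) : degree v <= max_degree G.
Proof. exact: (leq_bigmax v). Qed.

Lemma Lambda2_pair {G : sgraph} (x z : G) :
  Lambda2 [set x; z] \subset nbhd x :&: nbhd z.
Proof.
apply/subsetP => y; rewrite !inE => y2.
have /subset_leqif_cards [le_card eq_card] := subsetIr (nbhd y) [set x; z].
(* The intersection has at least two elements and [[set x; z]] at most two, so the inclusion is an
   equality. *)
have : nbhd y :&: [set x; z] == [set x; z].
  rewrite -eq_card eqn_leq le_card; apply: leq_trans y2.
  by rewrite cards2; case: (x != z).
move/eqP/setIidPr/subsetP => sub.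
have := sub _ (set21 x z); have := sub _ (set22 x z).
by rewrite !inE ![adj y _]adj_sym => -> ->.
Qed.

Lemma double_Hall_common_nbhd {G : sgraph} {X : {set G}} {x z : G} :
  double_Hall X -> x \in X -> z \in X -> x != z ->
  2 <= #|nbhd x :&: nbhd z|.
Proof.
move=> dhG xX zX xz; have card_xz : #|[set x; z]| = 2 by rewrite cards2 xz.
have sub_xz : [set x; z] \subset X by rewrite subUset !sub1set xX.
apply: leq_trans (subset_leq_card (Lambda2_pair x z)).
by rewrite -[leqLHS]card_xz dhG ?card_xz.
Qed.

(** Double counting: both sides count the pairs [(y, z)] with [z] in [A] and [y] adjacent to both
    [x] and [z], grouped by [z] on the left and by [y] on the right. *)
Lemma sum_common_nbhd {G : sgraph} (x : G) (A : {set G}) :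
  \sum_(z in A) #|nbhd x :&: nbhd z| = \sum_(y in nbhd x) #|nbhd y :&: A|.
Proof.
have cardI (B C : {set G}) : #|B :&: C| = \sum_(y in B) (y \in C).
  by rewrite -sum1_card big_mkcond [RHS]big_mkcond; apply: eq_bigr => y _;
    rewrite inE; do 2 case: (_ \in _).
under eq_bigr do rewrite cardI.
rewrite exchange_big /=; apply: eq_bigr => y _; rewrite setIC cardI.
by apply: eq_bigr => z _; rewrite !inE adj_sym.
Qed.

Lemma double_Hall_degree_bound {G : sgraph} {X : {set G}} {x : G} :
  double_Hall X -> x \in X ->
  2 * #|X :\ x| <= max_degree G * (max_degree G).-1.
Proof.
move=> dhG xX.
apply: (@leq_trans (\sum_(z in X :\ x) #|nbhd x :&: nbhd z|)).
  rewrite mulnC -sum_nat_const; apply: leq_sum => z /setD1P[zx zX].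
  by rewrite (double_Hall_common_nbhd dhG) // eq_sym.
rewrite sum_common_nbhd.
apply: (@leq_trans (\sum_(y in nbhd x) (max_degree G).-1)).
  apply: leq_sum => y; rewrite inE adj_sym => xy.
  (* The inequality is strict because [x] itself is a neighbour of [y] lying outside [X :\ x]. *)
  have lt_deg : #|nbhd y :&: (X :\ x)| < degree y.
    apply/proper_card/properP; split; first exact: subsetIl.
    by exists x; rewrite !inE ?eqxx ?andbF.
  have lt_max := leq_trans lt_deg (degree_le_max _).
  by rewrite -ltnS (ltn_predK lt_max).
by rewrite sum_nat_const leq_mul2r degree_le_max orbT.
Qed.

Theorem theorem1p10 (R : rcfType) (G : sgraph) (X Y : {set G}) (n d : nat)
  (bipG : bipartition X Y)
  (dhG : double_Hall X)
  (cardX : #|X| = n) (n_ge2 : 2 <= n)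
  (maxdeg : max_degree G = d) :
  n <= 'C(d, 2) + 1 /\ (Num.sqrt ((2 * n)%:R : R) <= d%:R)%R.
Proof.
have [x xX] : exists x, x \in X.
  by apply/set0Pn; rewrite -card_gt0 cardX; apply: ltnW.
have cardXx : n = #|X :\ x|.+1 by rewrite -cardX (cardsD1 x) xX.
have := double_Hall_degree_bound dhG xX; rewrite maxdeg => bound.
(* For [d <= 1] the right side of [bound] vanishes, while its left side is positive since
   [n >= 2]. *)
have d_ge2 : 2 <= d.
  by move: n_ge2 bound; rewrite cardXx; case: #|_| => [|k]; case: (d) => [|[|?]].
split.
  by rewrite cardXx addn1 ltnS bin2 -(doubleK #|_|) half_leq // -mul2n.
(* Here 2n = 2 + 2(n-1) <= d + d(d-1) = d^2, where [d_ge2] absorbs the summand 2. *)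
have le_sqr : 2 * n <= d ^ 2.
  rewrite cardXx mulnS; apply: leq_trans (leq_add d_ge2 bound) _.
  by rewrite -mulnS prednK // ltnW.
(* Writing d as |d|, the square root of d^2, reduces the claim to [le_sqr] by monotonicity of the
   square root. *)
rewrite -[leRHS]Num.Theory.ger0_norm ?Num.Theory.ler0n //.
rewrite -Num.Theory.sqrtr_sqr -GRing.natrX.
by apply: Num.Theory.ler_wsqrtr; rewrite Num.Theory.ler_nat.
Qed.
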